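(* Let $n$ be a positive integer, let $\epsilon>0$, and let $\mathcal{A}\subset\{0,1\}^n$ satisfy $\mu(\mathcal{A})\ge\epsilon$. Let $C=\frac{\log(2/\epsilon)}{\epsilon^2}$. Then for every $(\epsilon/2,C)$-well-spread subset $S\subset\{0,1\}^n$, $$\mu(\mathcal{A}+S)\ge 1-\epsilon .$$
   Context: $\mu(\mathcal{A})=|\mathcal{A}|/2^n$ for $\mathcal{A}\subset\{0,1\}^n$. Addition in $\{0,1\}^n$ is coordinatewise modulo 2, and $\mathcal{A}+S=\{a+s : a\in\mathcal{A}, s\in S\}$. For $P\in[0,1]^n$, $Y_P$ denotes the random vector in $\{0,1\}^n$ whose coordinates are independent Bernoulli random variables with $\mathbb{P}((Y_P)_i=1)=P_i$. A subset $S\subset\{0,1\}^n$ is $(\gamma,C)$-well-spread if for every $P\in[0,1]^n$ with $\|P\|_2^2=\sum_i P_i^2\le C$ we have $\mathbb{P}(Y_P\in S)>1-\gamma$. $\log$ is the natural logarithm. *)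

(* Defs.v *)
From HB Require Import structures.
From mathcomp Require Import all_boot all_order all_algebra.
From mathcomp Require Import classical_sets reals exp probability.

Set Implicit Arguments.
Unset Strict Implicit.
Unset Printing Implicit Defensive.

Import Order.TTheory GRing.Theory Num.Theory.
Local Open Scope ring_scope.

(* {0,1}^n is the finite additive group 'rV['F_2]_n, whose addition is
   coordinatewise addition modulo 2. *)

Definition density (R : realType) (n : nat) (A : {set 'rV['F_2]_n}) : R :=
  #|A|%:R / 2 ^+ n.

Definition sumset (n : nat) (A S : {set 'rV['F_2]_n}) : {set 'rV['F_2]_n} :=
  [set a + s | a in A, s in S].

(* The law of Y_P: independence of the coordinates means that the joint
   probability mass function is the product of the Bernoulli ones. *)
Definition bernoulli_vec_pmf (R : realType) (n : nat) (P : 'rV[R]_n)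
    (y : 'rV['F_2]_n) : R :=
  \prod_(i < n) bernoulli_pmf (P 0 i) (y 0 i == 1).

Definition bernoulli_vec_prob (R : realType) (n : nat) (P : 'rV[R]_n)
    (S : {set 'rV['F_2]_n}) : R :=
  \sum_(y in S) bernoulli_vec_pmf P y.

(* The squared Euclidean norm is spelled out because the library norm `|P| on
   matrices is the sup norm. *)
Definition well_spread (R : realType) (n : nat) (gamma C : R)
    (S : {set 'rV['F_2]_n}) : Prop :=
  forall P : 'rV[R]_n,
    (forall i, 0 <= P 0 i <= 1) ->
    \sum_(i < n) P 0 i ^+ 2 <= C ->
    1 - gamma < bernoulli_vec_prob P S.

(* Main.v *)
Require Import Defs.
From mathcomp Require Import all_boot all_order all_algebra.
From mathcomp Require Import classical_sets reals exp probability.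
From mathcomp Require Import ring lra.
Import Order.TTheory GRing.Theory Num.Theory.
Local Open Scope ring_scope.

(* A uniform point [a] of [A] can be coupled with a uniform point [b] of the
   cube so that, given [a], the coordinates of [a + b] are independent: reveal
   [a] one coordinate at a time and flip the likelier value of each bit just
   often enough to make it fair.  If [P a] is the vector of flip probabilities,
   then [a + b] has the law of [Y_(P a)] and the mean of [|P a|^2] is at most
   twice the relative entropy [ln (1 / mu A)].  If [B], the complement of
   [A + S], had density above [eps], then [b] would lie in [B] with probability
   above [eps]; but [a + b] is then outside [S], which has probability below
   [eps / 2] unless [|P a|^2 > C], and by Markov's inequality the latter costs
   at most another [eps / 2] when [eps < 1 / 2].  For larger [eps] it is enough
   that [A + S] is at least as large as [A]. *)

(** * Balancing a single bit *)

(* This is [ln z <= z - 1] at [z = sqrt (m / x)]. *)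
Lemma entropy_ge_sqrt (R : realType) (x m : R) : 0 <= x -> 0 < m ->
  x * ln m + 2 * (x - Num.sqrt x * Num.sqrt m) <= x * ln x.
Proof.
rewrite le_eqVlt => /orP[/eqP <-|x_gt0] m_gt0.
  by rewrite sqrtr0 !mul0r subrr mulr0 addr0.
have sx_gt0 : 0 < Num.sqrt x by rewrite sqrtr_gt0.
have sm_gt0 : 0 < Num.sqrt m by rewrite sqrtr_gt0.
have := @le_ln1Dx R (Num.sqrt m / Num.sqrt x - 1).
have -> : -1 < Num.sqrt m / Num.sqrt x - 1.
  by have := divr_gt0 sm_gt0 sx_gt0; lra.
rewrite addrC subrK ln_div ?posrE// => /(_ isT) h.
have lnE (z : R) : 0 < z -> ln z = 2 * ln (Num.sqrt z).
  move=> z_gt0; rewrite -{1}(sqr_sqrtr (ltW z_gt0)) expr2.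
  by rewrite lnM ?posrE ?sqrtr_gt0//; lra.
rewrite (lnE m)// (lnE x)//.
have : x * (ln (Num.sqrt m) - ln (Num.sqrt x)) <=
    Num.sqrt x * Num.sqrt m - x.
  have -> : Num.sqrt x * Num.sqrt m - x = x * (Num.sqrt m / Num.sqrt x - 1).
    rewrite -{2 3}(sqr_sqrtr (ltW x_gt0)); field.
    exact: lt0r_neq0.
  by rewrite ler_pM2l.
lra.
Qed.

(** The left side is the cost of moving mass [(x - y) / 2] from the heavier value to the lighter
    one. Adding [entropy_ge_sqrt] for [x] and [y] at their mean [m] leaves an inequality between
    square roots. *)
Lemma two_point_entropy (R : realType) (x y : R) : 0 <= y -> y < x ->
  x * ((x - y) / (2 * x)) ^+ 2 <=
    2 * (x * ln x + y * ln y - (x + y) * ln ((x + y) / 2)).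
Proof.
move=> y_ge0 y_lt_x; have x_gt0 : 0 < x by lra.
set m := (x + y) / 2; have m_gt0 : 0 < m by rewrite /m; lra.
have hx := @entropy_ge_sqrt R x m (ltW x_gt0) m_gt0.
have hy := @entropy_ge_sqrt R y m y_ge0 m_gt0.
have -> : x * ((x - y) / (2 * x)) ^+ 2 = (x - y) ^+ 2 / (4 * x).
  by field; exact: lt0r_neq0.
suff : (x - y) ^+ 2 / (4 * x) <=
    4 * (x + y - Num.sqrt m * (Num.sqrt x + Num.sqrt y)) by lra.
clear hx hy.
have ex := sqr_sqrtr (ltW x_gt0); have ey := sqr_sqrtr y_ge0.
have em := sqr_sqrtr (ltW m_gt0).
have s_gt0 : 0 < Num.sqrt x by rewrite sqrtr_gt0.
have u_ge0 : 0 <= Num.sqrt y by exact: sqrtr_ge0.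
have u_le_s : Num.sqrt y <= Num.sqrt x by rewrite ler_sqrt// ltW.
move: (Num.sqrt x) (Num.sqrt y) (Num.sqrt m) => s u v
  in ex ey em s_gt0 u_ge0 u_le_s *.
have em' : 2 * v ^+ 2 = s ^+ 2 + u ^+ 2 by rewrite em ex ey /m; field.
(* The left inequality uses [x - y = (s - u) * (s + u)] and [s + u <= 2 * s]; the right one is
   [(2 * v - (s + u)) ^+ 2 >= 0] combined with [em']. *)
apply: (@le_trans _ _ ((s - u) ^+ 2)).
  rewrite ler_pdivrMr; last by lra.
  rewrite -ex -ey subr_sqr exprMn; apply: ler_wpM2l; first exact: sqr_ge0.
  rewrite (_ : 4 * s ^+ 2 = (2 * s) ^+ 2); last by ring.
  by rewrite ler_pXn2r ?nnegrE//; lra.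
rewrite -ex -ey.
have := sqr_ge0 (2 * v - (s + u)).
nra.
Qed.

Lemma sum_F2 (V : nmodType) (F : 'F_2 -> V) : \sum_c F c = F 0 + F 1.
Proof.
rewrite big_ord_recl big_ord1; congr (F _ + F _).
exact: val_inj.
Qed.

(** Here [w c] is the weight of the bit [c] and [r c] its flip probability; the flip that turns [c]
    into [d] is [c + d]. *)
Lemma bit_coupling (R : realType) (w : 'F_2 -> R) : (forall c, 0 <= w c) ->
  exists r : 'F_2 -> R, [/\ forall c, 0 <= r c <= 1,
    forall d, \sum_c w c * bernoulli_pmf (r c) (c + d == 1) =
      (\sum_c w c) / 2 &
    \sum_c w c * r c ^+ 2 <= 2 * (\sum_c w c * ln (w c) -
      (\sum_c w c) * ln ((\sum_c w c) / 2))].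
Proof.
move=> w_ge0.
have F2P (c : 'F_2) : c = 0 \/ c = 1.
  by case: c => [[|[|]]]// ?; [left|right]; exact: val_inj.
(* Only a strictly heavier value is flipped, so the denominator is positive, and half of its excess
   weight moves across. *)
exists (fun c => if w (c + 1) < w c then (w c - w (c + 1)) / (2 * w c) else 0).
have e11 : (1 + 1 : 'F_2) = 0 by exact: val_inj.
split=> [c|d|].
- case: ifPn => // h; last by rewrite lexx ler01.
  have := w_ge0 (c + 1) => h1.
  rewrite divr_ge0 ?ler_pdivrMr; lra.
- have h0 := w_ge0 0; have h1 := w_ge0 1.
  rewrite !sum_F2 add0r e11.
  have [->|->] := F2P d; rewrite ?addr0 ?add0r ?e11 /= ?eqxx ?oner_eq0 ?(eq_sym 0);
    case: (ltgtP (w 0) (w 1)) => h /=; rewrite /bernoulli_pmf ?h; field => //;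
    by apply: lt0r_neq0; lra.
- have h0 := w_ge0 0; have h1 := w_ge0 1.
  rewrite !sum_F2 add0r e11.
  case: (ltgtP (w 0) (w 1)) => h.
  + have := two_point_entropy _ _ _ h0 h.
    by rewrite expr0n/= mulr0 add0r (addrC (w 1) (w 0)) (addrC (w 1 * ln _)).
  + have := two_point_entropy _ _ _ h1 h.
    by rewrite expr0n/= mulr0 addr0.
  + rewrite -h expr0n/= !mulr0 addr0.
    have -> : (w 0 + w 0) / 2 = w 0 by field.
    rewrite -mulrDl subrr mulr0//.
Qed.

(** * Splitting off the first coordinate *)

Definition row_cons (T : Type) (n : nat) (c : T) (v : 'rV[T]_n) : 'rV[T]_n.+1 :=
  \row_i oapp (v 0) c (unlift ord0 i).

Definition row_behead (T : Type) (n : nat) (v : 'rV[T]_n.+1) : 'rV[T]_n :=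
  \row_i v 0 (lift ord0 i).

Arguments row_cons {T n} c v.
Arguments row_behead {T n} v.

Lemma row_cons0 (T : Type) (n : nat) (c : T) (v : 'rV[T]_n) :
  row_cons c v 0 ord0 = c.
Proof. by rewrite mxE unlift_none. Qed.

Lemma row_cons_lift (T : Type) (n : nat) (c : T) (v : 'rV[T]_n) i :
  row_cons c v 0 (lift ord0 i) = v 0 i.
Proof. by rewrite mxE liftK. Qed.

Lemma row_consK (T : Type) (n : nat) (c : T) (v : 'rV[T]_n) :
  row_behead (row_cons c v) = v.
Proof. by apply/rowP => i; rewrite mxE row_cons_lift. Qed.

Lemma row_beheadK (T : Type) (n : nat) (v : 'rV[T]_n.+1) :
  row_cons (v 0 ord0) (row_behead v) = v.
Proof.
by apply/rowP => i; rewrite mxE; case: unliftP => [j|] -> //=; rewrite mxE.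
Qed.

Lemma row_consD (n : nat) (c d : 'F_2) (v w : 'rV['F_2]_n) :
  row_cons c v + row_cons d w = row_cons (c + d) (v + w).
Proof. by apply/rowP => i; rewrite !mxE; case: unlift => [j|] //=; rewrite mxE. Qed.

Lemma sum_row_cons (V : nmodType) (n : nat) (F : 'rV['F_2]_n.+1 -> V) :
  \sum_v F v = \sum_c \sum_v F (row_cons c v).
Proof.
rewrite pair_bigA (reindex (fun p => row_cons p.1 p.2))//=.
exists (fun v : 'rV['F_2]_n.+1 => (v 0 ord0, row_behead v)) => [[c v] _|v _] /=.
  by rewrite row_cons0 row_consK.
exact: row_beheadK.
Qed.

Lemma bernoulli_vec_pmf_cons (R : realType) (n : nat) (p : R) (P : 'rV[R]_n)
    (c : 'F_2) (v : 'rV['F_2]_n) :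
  bernoulli_vec_pmf (row_cons p P) (row_cons c v) =
    bernoulli_pmf p (c == 1) * bernoulli_vec_pmf P v.
Proof.
rewrite /bernoulli_vec_pmf big_ord_recl !row_cons0; congr (_ * _).
by apply: eq_bigr => i _; rewrite !row_cons_lift.
Qed.

Lemma sum_bernoulli_vec_pmf (R : realType) (n : nat) (P : 'rV[R]_n) :
  \sum_y bernoulli_vec_pmf P y = 1.
Proof.
elim: n P => [|n IHn] P.
  rewrite (big_pred1 0) => [|y]; first by rewrite /bernoulli_vec_pmf big_ord0.
  by rewrite [y]thinmx0 /= eqxx.
rewrite sum_row_cons -[P]row_beheadK.
under eq_bigr => c _.
  under eq_bigr => v _ do rewrite bernoulli_vec_pmf_cons.
  rewrite -big_distrr/= IHn mulr1.
  over.
by rewrite sum_F2 /bernoulli_pmf /=; ring.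
Qed.

(** * The coupling on the whole cube *)

(** Induction on [n]: the tails are coupled within each slice given by the first bit, then the first
    bit is balanced. The weights are not normalised, so that a slice of [f] is again an instance. *)
Lemma uniform_coupling (R : realType) (n : nat) (f : 'rV['F_2]_n -> R) :
  (forall a, 0 <= f a) ->
  exists P : 'rV['F_2]_n -> 'rV[R]_n,
    [/\ forall a i, 0 <= P a 0 i <= 1,
      forall b, \sum_a f a * bernoulli_vec_pmf (P a) (a + b) =
        (\sum_a f a) / 2 ^+ n &
      \sum_a f a * \sum_(i < n) P a 0 i ^+ 2 <=
        2 * (\sum_a f a * ln (f a) -
             (\sum_a f a) * ln ((\sum_a f a) / 2 ^+ n))].
Proof.
elim: n f => [|n IHn] f f_ge0.
  have sum0 (F : 'rV['F_2]_0 -> R) : \sum_a F a = F 0.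
    by rewrite (big_pred1 0) => // y; rewrite [y]thinmx0 /= eqxx.
  exists (fun=> 0); split=> [a []//|b|]; rewrite !sum0 expr0 divr1.
    by rewrite /bernoulli_vec_pmf big_ord0 mulr1.
  by rewrite big_ord0 mulr0 subrr mulr0.
have /fin_all_exists[P_ PP] :
  forall c : 'F_2, _ := fun c => IHn (fun v => f (row_cons c v)) (fun v => f_ge0 _).
set F := fun c => \sum_v f (row_cons c v) in PP *.
have F_ge0 c : 0 <= F c by apply: sumr_ge0.
have p2_gt0 : (0 : R) < 2 ^+ n by rewrite exprn_gt0.
have p2_neq0 := lt0r_neq0 p2_gt0.
(* By induction, the slice of first bit [c] hits every tail with the same weight [F c / 2 ^+ n];
   these are the two weights left to balance. *)
have [c|r [r01 rU rE]] := bit_coupling _ (fun c => F c / 2 ^+ n).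
  by rewrite divr_ge0// ltW.
exists (fun a : 'rV['F_2]_n.+1 => row_cons (r (a 0 ord0)) (P_ (a 0 ord0) (row_behead a))).
have sumf : \sum_a f a = \sum_c F c by rewrite sum_row_cons.
split=> [a i|b|].
- rewrite mxE; case: unlift => [j|] //=.
  by have [] := PP (a 0 ord0).
- rewrite [LHS]sum_row_cons -[b]row_beheadK sumf.
  under eq_bigr => c _.
    under eq_bigr => v _.
      rewrite row_cons0 row_consK row_consD bernoulli_vec_pmf_cons mulrCA.
      over.
    rewrite -big_distrr/=; have [_ -> _] := PP c; rewrite -/(F c) mulrC.
    over.
  by rewrite rU -big_distrl/= exprS; field.
- rewrite sumf !sum_row_cons.
  under eq_bigr => c _.
    under eq_bigr => v _.
      rewrite row_cons0 row_consK big_ord_recl row_cons0.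
      under [X in _ + X]eq_bigr => i _ do rewrite row_cons_lift.
      rewrite mulrDr.
      over.
    rewrite big_split/= -big_distrl/= -/(F c).
    over.
  rewrite big_split/=.
  have h1 : \sum_c \sum_v f (row_cons c v) * \sum_(i < n) P_ c v 0 i ^+ 2 <=
      \sum_c 2 * (\sum_v f (row_cons c v) * ln (f (row_cons c v)) -
        F c * ln (F c / 2 ^+ n)).
    by apply: ler_sum => c _; have [] := PP c.
  (* Chain rule for entropy: the terms [F c * ln (F c / 2 ^+ n)] cancel between the bound for the
     tails and [2 ^+ n] times the bound for the first bit. *)
  move: h1 rE; rewrite -!big_distrr/= sumrB -!big_distrl/=.
  have -> : \sum_c F c / 2 ^+ n * r c ^+ 2 = (\sum_c F c * r c ^+ 2) / 2 ^+ n.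
    by rewrite big_distrl; apply: eq_bigr => c _ /=; rewrite mulrAC.
  have -> : \sum_c F c / 2 ^+ n * ln (F c / 2 ^+ n) =
      (\sum_c F c * ln (F c / 2 ^+ n)) / 2 ^+ n.
    by rewrite [RHS]big_distrl; apply: eq_bigr => c _ /=; rewrite mulrAC.
  rewrite ler_pdivrMr// => h1.
  have -> : (\sum_c F c) / 2 ^+ n.+1 = (\sum_c F c) / 2 ^+ n / 2.
    by rewrite exprS; field.
  set G := ln _; set K := (X in X <= _).
  have -> : 2 * ((\sum_c F c * ln (F c / 2 ^+ n)) / 2 ^+ n -
      (\sum_c F c) / 2 ^+ n * G) * 2 ^+ n =
    2 * (\sum_c F c * ln (F c / 2 ^+ n) - (\sum_c F c) * G) by field.
  by rewrite {}/K; lra.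
Qed.

(** * From the coupling to the density of the sumset *)

(** This is what makes the Markov term at most [eps / 2]. By monotonicity [alpha] may be replaced by
    [eps], and the claim becomes [- ln eps * (4 * eps - 1) <= ln 2]. It is clear for [eps <= 1 / 4];
    beyond that, the tangent of [ln] at 1 bounds [- ln (2 * eps)]. *)
Lemma entropy_cost_bound (R : realType) (eps alpha : R) :
  0 < eps -> eps < 1 / 2 -> eps <= alpha -> alpha <= 1 ->
  2 * - ln alpha <= eps / 2 * (ln (2 / eps) / eps ^+ 2).
Proof.
move=> e_gt0 e_lt le_ea a_le1.
have l2 : 1 / 2 <= ln (2 : R).
  have := @le_ln1Dx R (1 / 2 - 1).
  rewrite (addrC 1) subrK mul1r lnV ?posrE//= => /(_ _); lra.
have h1 : ln eps <= ln alpha by rewrite ler_ln ?posrE//; lra.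
have h2 : - ln eps <= ln 2 + ((2 * eps)^-1 - 1).
  have i_gt0 : 0 < (2 * eps)^-1 by rewrite invr_gt0; lra.
  have := @le_ln1Dx R ((2 * eps)^-1 - 1).
  rewrite (addrC 1) subrK lnV ?posrE; last lra.
  rewrite lnM ?posrE// => /(_ _); lra.
rewrite ln_div ?posrE//.
have -> : eps / 2 * ((ln 2 - ln eps) / eps ^+ 2) = (ln 2 - ln eps) / (2 * eps).
  by field; exact: lt0r_neq0.
rewrite ler_pdivlMr; last lra.
suff : - ln eps * (4 * eps - 1) <= ln 2 by nra.
move: h2; set i := (2 * eps)^-1 => h2.
have ie : i * (2 * eps) = 1 by rewrite /i mulVf// lt0r_neq0//; lra.
have i_ge1 : 1 <= i by nra.
have [h|h] := leP (4 * eps) 1.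
  have : ln eps <= 0 by apply: ln_le0; lra.
  nra.
(* As [4 * eps * i = 2], multiplying the remaining inequality by [i] gives
   [(i - 1) * (2 - i - 2 * ln 2) <= 0], which follows from [i_ge1] and [l2]. *)
apply: (@le_trans _ _ ((ln 2 + (i - 1)) * (4 * eps - 1))).
  by rewrite ler_wpM2r//; lra.
nra.
Qed.

Lemma card_sumset_ge (n : nat) (A S : {set 'rV['F_2]_n}) (s : 'rV['F_2]_n) :
  s \in S -> (#|A| <= #|sumset A S|)%N.
Proof.
move=> sS; rewrite -(card_imset (mem A) (addIr s)); apply: subset_leq_card.
apply/fintype.subsetP => _ /imsetP[a aA ->]; exact: imset2_f.
Qed.

Theorem corollary1p3 (R : realType) (n : nat) (n_gt0 : (0 < n)%N)
    (eps : R) (eps_gt0 : 0 < eps)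
    (A : {set 'rV['F_2]_n}) (muA : eps <= density R A)
    (S : {set 'rV['F_2]_n})
    (S_spread : well_spread (eps / 2) (ln (2 / eps) / eps ^+ 2) S) :
  1 - eps <= density R (sumset A S).
Proof.
have p2_gt0 : (0 : R) < 2 ^+ n by rewrite exprn_gt0.
have cardT : #|'rV['F_2]_n|%:R = 2 ^+ n :> R.
  by rewrite card_mx card_Fp// mul1n natrX.
have density_le1 (B : {set 'rV['F_2]_n}) : density R B <= 1.
  by rewrite /density ler_pdivrMr// mul1r -cardT ler_nat max_card.
have eps_le1 : eps <= 1 by exact: le_trans muA _.
set C := ln (2 / eps) / eps ^+ 2 in S_spread.
have C_gt0 : 0 < C.
  rewrite divr_gt0 ?exprn_gt0// ln_gt0// ltr_pdivlMr//; lra.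
(* When [eps >= 1 / 2], [1 - eps <= eps], so a single element of [S] is enough; testing the spread
   at [P = 0] provides one. *)
have [e_lt|e_ge] := ltP eps (1 / 2); last first.
  have [s sS] : exists s, s \in S.
    apply/set0Pn/eqP => S0; have : 1 - eps / 2 < bernoulli_vec_prob 0 S.
      apply: S_spread => [i|]; first by rewrite mxE lexx ler01.
      by rewrite big1 ?ltW// => i _; rewrite mxE expr0n.
    by rewrite S0 /bernoulli_vec_prob big_set0; lra.
  have : density R A <= density R (sumset A S).
    by rewrite /density ler_pM2r ?invr_gt0// ler_nat (card_sumset_ge _ _ _ s).
  lra.
rewrite leNgt; apply/negP => lt_AS.
pose B := ~: sumset A S.
pose f (a : 'rV['F_2]_n) : R := (a \in A)%:R.
have f_ge0 a : 0 <= f a by rewrite ler0n.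
have [P [P01 PU PE]] := uniform_coupling _ _ _ f_ge0.
have sumf : \sum_a f a = #|A|%:R.
  rewrite -sum1_card natr_sum [RHS]big_mkcond; apply: eq_bigr => a _.
  by rewrite /f; case: (a \in A).
(* For an indicator the entropy bound collapses to [2 * - (#|A| * ln (density A))]. *)
have sumfln : \sum_a f a * ln (f a) = 0.
  by apply: big1 => a _; rewrite /f; case: (a \in A); rewrite ?mul0r// ln1 mulr0.
rewrite sumf sumfln sub0r in PE PU.
rewrite -/(density R A) in PE PU.
have A_gt0 : (0 : R) < #|A|%:R.
  have := lt_le_trans eps_gt0 muA.
  by rewrite /density pmulr_lgt0 ?invr_gt0.
have pmf_ge0 a y : 0 <= bernoulli_vec_pmf (P a) y.
  apply: prodr_ge0 => i _; have /andP[h0 h1] := P01 a i.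
  by rewrite /bernoulli_pmf; case: ifP => _; rewrite ?subr_ge0.
(* The conditional probability that [b] lies in [B], given [a]. *)
pose q a := \sum_(b in B) bernoulli_vec_pmf (P a) (a + b).
have qE a : q a = \sum_(y | a + y \in B) bernoulli_vec_pmf (P a) y.
  have aa : a + a = 0.
    by apply/rowP => i; rewrite !mxE -mulr2n -mulr_natr (_ : 2%:R = 0) ?mulr0//; exact: val_inj.
  rewrite /q (reindex_inj (addrI a)) /=.
  by apply: eq_bigr => y _; rewrite addrA aa add0r.
(* Markov's inequality in pointwise form: the term divided by [C] is at least 1 when the spread
   hypothesis does not apply to [P a]. *)
have q_le a : a \in A -> q a <= eps / 2 + (\sum_(i < n) P a 0 i ^+ 2) / C.
  move=> aA; set N := \sum_(i < n) _.
  have N_ge0 : 0 <= N by apply: sumr_ge0 => i _; exact: sqr_ge0.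
  have sum1 := sum_bernoulli_vec_pmf R n (P a).
  have [N_le|N_gt] := leP N C; last first.
    have : 1 <= N / C by rewrite ler_pdivlMr// mul1r ltW.
    suff : q a <= 1 by lra.
    rewrite qE -sum1 [leRHS](bigID (fun y => a + y \in B))/= lerDl.
    exact: sumr_ge0.
  have := S_spread (P a) (P01 a) N_le.
  (* The two events are disjoint: [y] in [S] puts [a + y] in [A + S], hence outside [B]. *)
  have : q a + bernoulli_vec_prob (P a) S <= 1.
    rewrite qE -sum1 [leRHS](bigID (fun y => y \in S))/= addrC; apply: lerD => //.
    rewrite big_mkcond [leRHS]big_mkcond ler_sum// => y _.
    have [yS|_] := boolP (y \in S); last by case: ifP; rewrite ?pmf_ge0.
    by rewrite inE imset2_f.
  have : 0 <= N / C by rewrite divr_ge0// ltW.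
  lra.
(* Summing over [a] first, each [b] carries the same weight [density A]. *)
have sumq : \sum_a f a * q a = #|B|%:R * density R A.
  under eq_bigr => a _ do rewrite big_distrr/=.
  rewrite exchange_big/=.
  by under eq_bigr => b _ do rewrite PU; rewrite sumr_const mulr_natl.
have le1 : \sum_a f a * q a <=
    \sum_a f a * (eps / 2) + (\sum_a f a * \sum_(i < n) P a 0 i ^+ 2) / C.
  rewrite [X in _ + X]big_distrl/= -big_split/=; apply: ler_sum => a _.
  rewrite -mulrA -mulrDr /f; have [/q_le h|_] := boolP (a \in A).
    by rewrite !mul1r.
  by rewrite !mul0r.
rewrite -big_distrl/= sumf sumq in le1.
have le2 : (\sum_a f a * \sum_(i < n) P a 0 i ^+ 2) / C <= #|A|%:R * (eps / 2).
  rewrite ler_pdivrMr//; apply: (le_trans PE).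
  have h := entropy_cost_bound _ _ _ eps_gt0 e_lt muA (density_le1 A).
  have -> : 2 * - (#|A|%:R * ln (density R A)) = #|A|%:R * (2 * - ln (density R A)).
    by ring.
  by rewrite -mulrA ler_pM2l.
have BE : #|B|%:R = 2 ^+ n * (1 - density R (sumset A S)).
  rewrite /B cardsCs finset.setCK natrB ?max_card// -?cardT /density.
  by rewrite cardT; field; exact: lt0r_neq0.
have : #|B|%:R * density R A = (1 - density R (sumset A S)) * #|A|%:R.
  by rewrite BE {2}/density; field; exact: lt0r_neq0.
have : eps * #|A|%:R < (1 - density R (sumset A S)) * #|A|%:R.
  by rewrite ltr_pM2r//; lra.
lra.
Qed.
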